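(* For coprime positive integers $m,n$, let $r_2(m,n)$ denote the largest perfect square that cannot be written as $mx+ny$ with $x,y$ nonnegative integers. Let $(u_n)_{n\ge1}$ be the sequence defined by $u_1=1$, $u_2=2$, $u_3=3$ and, for all $n\ge2$, $u_{2n}=u_{2n-1}+u_{2n-2}$ and $u_{2n+1}=u_{2n}+u_{2n-2}$. (1) Suppose $a=(2b+1)^2$ for some integer $b\ge1$. Then $$r_2(a,a+2)=\begin{cases}\left(a-2\left\lfloor\frac{(2b+1)\sqrt2}{2}\right\rfloor\right)^2, & \text{if } 2b+1\notin\bigcup_{n\ge1}\{u_{4n+1}\},\\ \left(a-2\left\lfloor\frac{(2b+1)\sqrt3-1}{2}\right\rfloor-1\right)^2, & \text{if } 2b+1\in\bigcup_{n\ge1}\{u_{4n+1}\}.\end{cases}$$ (2) Suppose $a+2=(2b+1)^2$ for some integer $b\ge1$. Then $$r_2(a,a+2)=\begin{cases}\left(a-2\left\lfloor\frac{(2b+1)\sqrt2}{2}\right\rfloor\right)^2, & \text{if } 2b+1\notin\bigcup_{n\ge0}\{u_{4n+3}\},\\ \left(a-2\left\lfloor\frac{(2b+1)\sqrt3-1}{2}\right\rfloor-1\right)^2, & \text{if } 2b+1\in\bigcup_{n\ge0}\{u_{4n+3}\}.\end{cases}$$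
   Context: The sequence $u_n$ begins $1,2,3,5,7,12,17,29,41,70,99,169,239,408,577,985,\ldots$. *)

(* Defs.v *)
From mathcomp Require Import all_boot all_order all_algebra.
From mathcomp Require Import reals.

Set Implicit Arguments.
Unset Strict Implicit.
Unset Printing Implicit Defensive.

Import Order.TTheory GRing.Theory Num.Theory.
Local Open Scope ring_scope.

(* The value at 0 is junk: the sequence starts at u 1, and the recursion
   never reaches back to u 0.  [uE] gives the defining equations. *)
Fixpoint u (n : nat) : nat :=
  match n with
  | 0 => 0
  | 1 => 1
  | 2 => 2
  | 3 => 3
  | (((k.+1 as k1).+1 as k2).+1 as k3).+1 =>
      if odd k then (u k3 + u k1)%N else (u k3 + u k2)%N
  end.

Lemma uE : [/\ u 1 = 1%N, u 2 = 2%N, u 3 = 3%N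
  & forall n : nat, (2 <= n)%N ->
      u (2 * n) = (u (2 * n - 1) + u (2 * n - 2))%N
      /\ u (2 * n + 1) = (u (2 * n) + u (2 * n - 2))%N].
Proof.
split=> // -[|[|n]] // _.
have -> : (2 * n.+2 = (2 * n).+4)%N by rewrite 2!mulnS.
by rewrite addn1 subn1 subn2 /= mul2n odd_double.
Qed.

(* k = m x + n y for some nonnegative integers x, y. *)
Definition representable (m n : nat) (k : int) : Prop :=
  exists x y : nat, k = (m * x + n * y)%N%:Z.

(* is_r2 m n r reads "r_2(m,n) is defined and equal to r".  It is a relation
   because r_2(m,n) does not exist when m = 1 or n = 1. *)
Definition is_r2 (m n : nat) (r : int) : Prop :=
  [/\ (0 < m)%N, (0 < n)%N & coprime m n] /\
  [/\ exists j : int, r = j ^+ 2,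
      ~ representable m n r
    & forall j : int, ~ representable m n (j ^+ 2) -> j ^+ 2 <= r].

(* Main.v *)
(* Since [a] is odd, (a - j)^2 = a x + (a + 2) y is solvable iff some c = j mod 2
   satisfies a c <= j^2 and (j + 2)^2 <= (a + 2) (c + 2) (put c = x + y - a + 2 j).
   Hence the even j that fail start where 2 (j/2)^2 < a and a + 2 < 2 (j/2 + 1)^2
   (between c = 0 and c = 2), and the odd ones where j^2 < 3 a and
   3 (a + 2) < (j + 2)^2 (between c = 1 and c = 3).  With q = 2 b + 1, the even gap
   closes up exactly when 2 x^2 = q^2 + 1 (part 1) or 2 x^2 = q^2 - 1 (part 2) for
   some x, that is, along the Pell subsequences of [u]; the answer then comes from
   the odd gap, which could only close up at a common solution of two Pell
   equations.  These are
     q^2 + 1 = 2 x^2, q^2 + 2 = 3 w^2, where (2 x - q) (2 x + q) = 3 w^2 forces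
     2 x - q or 2 x + q to be a square t^2, and then t^4 = 2 y^2 + 1;
     q^2 = 2 x^2 + 1, j^2 = 6 x^2 + 1, where (j - q)/2 and (j + q)/2 are squares
     m^2, n^2 with (n^2 - 2 m^2)^2 = 3 m^4 + 1, which is settled by Fermat descent
     and by the first system.
   The only solution that matters is q = 3, j = 5, that is a = 7. *)
Require Import Defs.
From mathcomp Require Import all_boot all_order all_algebra.
From mathcomp Require Import reals.
From mathcomp Require Import zify ring lra.
Set Implicit Arguments.
Unset Strict Implicit.
Unset Printing Implicit Defensive.
Import Order.TTheory GRing.Theory Num.Theory.

(** * Coprime factors of powers; residues of squares *)

Lemma coprime_square (a b c : nat) :
  coprime a b -> (a * b = c ^ 2)%N -> exists d, (a = d ^ 2)%N.
Proof.
move=> /eqP cab abc; exists (gcdn a c).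
(* [gcd(a, c)^2 = gcd(a^2, a c, c^2)]; since [c^2 = a b], a factor [a] comes out and leaves
   [gcd(a, b, c) = 1]. *)
rewrite -mulnn muln_gcdl !muln_gcdr (mulnn c) -abc (mulnC c a).
rewrite -!muln_gcdr.
by rewrite (gcdnC c b) gcdnACA cab gcd1n muln1.
Qed.

Lemma coprime_fourth (a b c : nat) :
  coprime a b -> (a * b = c ^ 4)%N ->
  exists d e, [/\ a = (d ^ 4)%N, b = (e ^ 4)%N & c = (d * e)%N].
Proof.
move=> cab; rewrite (expnM c 2 2) => abc.
have [d da] := coprime_square cab abc.
have [e eb] : exists e, (b = e ^ 2)%N.
  by apply: (@coprime_square b a (c ^ 2)); rewrite 1?coprime_sym 1?mulnC.
have dec : (d * e = c ^ 2)%N.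
  by apply/eqP; rewrite -(eqn_exp2r _ _ (isT : 0 < 2)%N) expnMn -da -eb abc.
have cde : coprime d e.
  by move: cab; rewrite da eb coprime_pexpl // coprime_pexpr.
have [f fd] := coprime_square cde dec.
have [g ge] : exists g, (e = g ^ 2)%N.
  by apply: (@coprime_square e d c); rewrite 1?coprime_sym 1?mulnC.
exists f, g; split; rewrite ?da ?eb ?fd ?ge -?expnM //.
by apply/eqP; rewrite -(eqn_exp2r _ _ (isT : 0 < 2)%N) expnMn -fd -ge dec.
Qed.

Lemma coprime_of_primes (a b : nat) :
  (forall p, prime p -> p %| a -> p %| b -> False)%N -> coprime a b.
Proof.
move=> H; have [g1|/pdiv_prime pp] := leqP (gcdn a b) 1.
  case: (posnP (gcdn a b)) => [|g0]; last by rewrite /coprime eqn_leq g1.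
  have := gcdn_gt0 a b => + g0; rewrite g0 => /esym/norP[a0 b0].
  by case: (H 2%N) => //; [have -> : a = 0%N by lia|have -> : b = 0%N by lia].
case: (H _ pp); apply: (dvdn_trans (pdiv_dvd _)); [exact: dvdn_gcdl|exact: dvdn_gcdr].
Qed.

Lemma odd_square (x : nat) : odd x -> exists k, (x ^ 2 = 8 * k + 1)%N.
Proof.
move=> h; have [k ->] : exists k, x = (2 * k + 1)%N by exists x./2; lia.
have [m km] : exists m, (k * k.+1 = 2 * m)%N.
  by exists ((k * k.+1)./2); have : ~~ odd (k * k.+1); [rewrite oddM /=; case: odd|lia].
by exists m; nia.
Qed.

Lemma square_mod3 (x : nat) : exists k, (x ^ 2 = 3 * k \/ x ^ 2 = 3 * k + 1)%N.
Proof.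
have [k] : exists k, (x = 3 * k \/ x = 3 * k + 1 \/ x = 3 * k + 2)%N.
  by exists (x %/ 3); lia.
case=> [->|[->|->]].
- by exists (3 * k ^ 2)%N; lia.
- by exists (3 * k ^ 2 + 2 * k)%N; lia.
- by exists (3 * k ^ 2 + 4 * k + 1)%N; lia.
Qed.

(** * The system q^2 + 1 = 2 x^2, q^2 + 2 = 3 w^2 *)

Lemma fourth_eq_2sqr_add1 (t Y : nat) : (t ^ 4 = 2 * Y ^ 2 + 1)%N -> t = 1%N.
Proof.
move=> h; have ot : odd t by have := f_equal odd h; rewrite oddX oddD oddM.
have [k tk] := odd_square ot.
(* (t^2 - 1) (t^2 + 1)/2 = Y^2 with coprime factors, so t^2 - 1 is a square. *)
have h2 : (8 * k * (4 * k + 1) = Y ^ 2)%N.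
  by move: h; rewrite (expnM t 2 2) tk; lia.
have cop : coprime (8 * k) (4 * k + 1).
  apply: coprime_of_primes => p pp p1 p2.
  have := dvdn_sub (dvdn_mull 2 p2) p1.
  have -> : (2 * (4 * k + 1) - 8 * k = 2)%N by lia.
  rewrite dvdn_prime2 // => /eqP p2'; move: p2; rewrite p2' dvdn2; lia.
have [e ek] := coprime_square cop h2.
(* Now [t^2 = e^2 + 1], and the only squares at distance 1 are 0 and 1. *)
have : (t = e \/ e < t)%N by nia.
nia.
Qed.

(** Multiplying [q + x sqrt 2], of norm -1, by [sqrt 2 - 1] or [sqrt 2 + 1] gives norm 1:
    [T = 2 x - q] satisfies [T^2 = 2 (x - q)^2 + 1], and likewise with plus signs. For [T = t^2] the
    previous quartic forces [t = 1]. *)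
Lemma simultaneous_pell_neg_sqr (q x t : nat) :
  (q ^ 2 + 1 = 2 * x ^ 2 -> q + t ^ 2 = 2 * x \/ 2 * x + q = t ^ 2 -> q = 1)%N.
Proof.
move=> hx h; suff t1 : t = 1%N by move: hx h; rewrite t1; nia.
have [y hy] : exists y, ((t ^ 2) ^ 2 = 2 * y ^ 2 + 1)%N.
  move: (t ^ 2)%N h => T [h|h].
  - have [Tx|xT] := leqP T x.
      have [y xE] : exists y, (x = T + y)%N by exists (x - T)%N; lia.
      have qE : (q = T + 2 * y)%N by lia.
      by exists y; move: hx; rewrite qE xE; clear; lia.
    have [y TE] : exists y, (T = x + y)%N by exists (T - x)%N; lia.
    have xE : (x = q + y)%N by lia.
    by exists y; move: hx; rewrite TE xE; clear; lia.
  - by exists (x + q)%N; rewrite -h; lia.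
by apply: (@fourth_eq_2sqr_add1 t y); rewrite (expnM t 2 2).
Qed.

Lemma simultaneous_pell_neg (q x w : nat) :
  (q ^ 2 + 1 = 2 * x ^ 2 -> q ^ 2 + 2 = 3 * w ^ 2 -> q = 1)%N.
Proof.
move=> hx hw.
have oq : odd q by have := f_equal odd hx; rewrite oddD oddX oddM /=; case: odd.
have [A [B [hA hB hAB]]] : exists A B,
    [/\ q + A = 2 * x, B = 2 * x + q & A * B = 3 * w ^ 2]%N.
  have qx : (q <= 2 * x)%N by rewrite -(leq_exp2r _ _ (isT : 0 < 2)%N) expnMn; lia.
  have [A hA] : exists A, (q + A = 2 * x)%N by exists (2 * x - q)%N; lia.
  exists A, (2 * x + q)%N; split=> //; rewrite -hw -hA.
  have : ((q + A) ^ 2 = 2 * (q ^ 2 + 1))%N by rewrite hA hx; lia.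
  by clear; lia.
have sAB : (A + B = 2 * (2 * x))%N by move: hA hB; clear; lia.
have oB : odd B by rewrite hB oddD oddM.
(* A common prime is odd, as [B] is, so it divides [x] and [q], hence also [2 x^2 - q^2 = 1]. *)
have cAB : coprime A B.
  apply: coprime_of_primes => p pp pA pB.
  have p2N : ~~ (p %| 2)%N.
    by rewrite dvdn_prime2 //; apply/eqP => p2; rewrite p2 dvdn2 oB in pB.
  have px : (p %| x)%N.
    by have := dvdn_add pA pB; rewrite sAB !Euclid_dvdM // (negbTE p2N).
  have pq : (p %| q)%N by rewrite -(dvdn_addr q (dvdn_mull 2 px)) -hB.
  have : (p %| 2 * x ^ 2 - q ^ 2)%N by apply: dvdn_sub; rewrite ?dvdn_mull // dvdn_exp.
  by rewrite -hx addKn dvdn1 => /eqP p1; rewrite p1 in pp.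
(* 3 divides one of the two coprime factors; the other one is then a square. *)
have : (3 %| A * B)%N by rewrite hAB dvdn_mulr.
rewrite Euclid_dvdM // => /orP[] /dvdnP[C hC].
- have cBC : coprime B C.
    by rewrite coprime_sym; apply: coprime_dvdl cAB; rewrite hC dvdn_mulr.
  have [|t ht] := coprime_square cBC (c := w); first by move: hAB; rewrite hC; clear; lia.
  by apply: (@simultaneous_pell_neg_sqr q x t hx); right; rewrite -hB.
- have cAC : coprime A C by apply: coprime_dvdr cAB; rewrite hC dvdn_mulr.
  have [|t ht] := coprime_square cAC (c := w); first by move: hAB; rewrite hC; clear; lia.
  by apply: (@simultaneous_pell_neg_sqr q x t hx); left; rewrite -ht.
Qed.

(** * Quartic equations solved by descent *)

Lemma coprime_consec (a b k l : nat) : (k * a + 1 = l * b)%N -> coprime a b.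
Proof.
move=> h; apply: coprime_of_primes => p pp pa pb.
have : (p %| k * a + 1)%N by rewrite h dvdn_mull.
by rewrite dvdn_addr ?dvdn_mull // dvdn1 => /eqP p1; rewrite p1 in pp.
Qed.

Lemma fourth_mod16 (x : nat) :
  exists k, (x ^ 4 = 16 * k \/ x ^ 4 = 16 * k + 1)%N.
Proof.
have [ox|ex] := boolP (odd x).
  have [k hk] := odd_square ox; exists (4 * k ^ 2 + k)%N; right.
  by rewrite (expnM x 2 2) hk; lia.
have [y ->] : exists y, (x = 2 * y)%N by exists x./2; lia.
by exists (y ^ 4)%N; left; rewrite expnMn.
Qed.

Lemma fourth_mod3 (x : nat) :
  exists k, (x ^ 4 = 3 * k \/ x ^ 4 = 3 * k + 1)%N.
Proof. by rewrite (expnM x 2 2); apply: square_mod3. Qed.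

(** The consecutive integers [(f^2 - 1)/2] and [(f^2 + 1)/2] have product [3 g^4]. As 3 cannot
    divide [f^2 + 1], they are [3 w^4] and [v^4]. *)
Lemma fourth_12_descent (f g : nat) : (f ^ 4 = 12 * g ^ 4 + 1)%N ->
  exists v w, [/\ v ^ 4 = 3 * w ^ 4 + 1, f ^ 2 + 1 = 2 * v ^ 4 & w * v = g]%N.
Proof.
move=> h.
have odd_f : odd f by have := f_equal odd h; rewrite oddX oddD oddM.
have [m hm] := odd_square odd_f.
have hk : (4 * m * (4 * m + 1) = 3 * g ^ 4)%N.
  by move: h; rewrite (expnM f 2 2) hm; lia.
have [h1 h1E] : exists h1, (4 * m = 3 * h1)%N.
  have : (3 %| 4 * m * (4 * m + 1))%N by rewrite hk dvdn_mulr.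
  rewrite Euclid_dvdM // => /orP[] /dvdnP[k kE]; first by exists k; lia.
  by have [l [] fl] := square_mod3 f; lia.
have cop : coprime h1 (4 * m + 1) by apply: (@coprime_consec _ _ 3 1); lia.
have [|w [v [hw hv ->]]] := @coprime_fourth _ _ g cop.
  by move: hk; rewrite h1E; clear; lia.
by exists v, w; split; move: h1E hw hv hm; clear; lia.
Qed.

(** Modulo 16, [w] is even. With [w = 2 z] and [v^2 = 8 m + 1] the equation reads
    [m (4 m + 1) = 3 z^4]; 3 cannot divide [4 m + 1 = (v^2 + 1)/2], so [m = 3 g^4] and
    [4 m + 1 = f^4]. *)
Lemma fourth_3_descent (v w : nat) : (v ^ 4 = 3 * w ^ 4 + 1)%N ->
  exists f g, [/\ f ^ 4 = 12 * g ^ 4 + 1, v ^ 2 + 1 = 2 * f ^ 4 & 2 * (g * f) = w]%N.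
Proof.
move=> h.
have ew : ~~ odd w.
  apply/negP => ow; have [k hk] := odd_square ow.
  have [l hl] := fourth_mod16 v.
  by move: h; rewrite (expnM w 2 2) hk; lia.
have [z zE] : exists z, (w = 2 * z)%N by exists w./2; lia.
have ov : odd v by have := f_equal odd h; rewrite zE oddX oddD oddM oddX oddM.
have [m hm] := odd_square ov.
have hk : (m * (4 * m + 1) = 3 * z ^ 4)%N.
  by move: h; rewrite zE (expnM v 2 2) hm; lia.
have [h1 h1E] : exists h1, (m = 3 * h1)%N.
  have : (3 %| m * (4 * m + 1))%N by rewrite hk dvdn_mulr.
  rewrite Euclid_dvdM // => /orP[] /dvdnP[k kE]; first by exists k; lia.
  by have [l [] vl] := square_mod3 v; lia.
have cop : coprime h1 (4 * m + 1) by apply: (@coprime_consec _ _ 12 1); lia.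
have [|g [f [hg hf zgf]]] := @coprime_fourth _ _ z cop.
  by rewrite {1}h1E in hk; move: hk; clear; lia.
by exists f, g; split; rewrite ?zE ?zgf //; move: h1E hg hf hm; clear; lia.
Qed.

(** Infinite descent: the two previous steps in turn give a solution [(v', w')] with [v' <= f < v]
    and [w = 2 g f], [g = w' v'], so [w' = 0] carries back to [w = 0]. *)
Lemma fourth_eq_3fourth_add1 (v w : nat) : (v ^ 4 = 3 * w ^ 4 + 1)%N -> w = 0%N.
Proof.
have [n] := ubnP v; elim: n => // n IH in v w * => vn h.
have [v1|v1] := leqP v 1.
  have v4 : (v ^ 4 <= 1)%N by rewrite -(exp1n 4) leq_exp2r.
  have /eqP : (w ^ 4 = 0)%N by move: (v ^ 4)%N (w ^ 4)%N h v4; clear; lia.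
  by rewrite expn_eq0 andbT => /eqP.
have [f [g [hf vf <-]]] := fourth_3_descent h.
have [v' [w' [hv fv <-]]] := fourth_12_descent hf.
have le24 k : (k ^ 2 <= k ^ 4)%N by case: k => // k; rewrite leq_pexp2l.
have fv1 : (f < v)%N.
  rewrite -(ltn_exp2r _ _ (isT : 0 < 2)%N).
  have : (2 ^ 2 <= v ^ 2)%N by rewrite leq_exp2r.
  by move: vf (le24 f); clear; lia.
have vf1 : (v' <= f)%N.
  rewrite -(leq_exp2r _ _ (isT : 0 < 2)%N).
  have : (0 < v' ^ 4)%N by rewrite hv addn1.
  by move: fv (le24 v'); clear; lia.
rewrite (IH v' w') //; move: vn fv1 vf1; clear; lia.
Qed.

Lemma fourth_eq_12fourth_add1 (f g : nat) : (f ^ 4 = 12 * g ^ 4 + 1)%N -> g = 0%N.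
Proof. by move=> /fourth_12_descent [v [w [/fourth_eq_3fourth_add1 -> _ <-]]]. Qed.

(** [3 b^4 = (2 a^2 - 1) (2 a^2 + 1)] with odd, hence coprime, factors; 3 divides the second since
    [a^2] is not 2 modulo 3. So [2 a^2 - 1 = v^4] and [2 a^2 + 1 = 3 w^4], the Pell system above
    with [q = v^2]. *)
Lemma mul4_fourth_eq_3fourth_add1 (a b : nat) :
  (4 * a ^ 4 = 3 * b ^ 4 + 1 -> a = 1 /\ b = 1)%N.
Proof.
move=> h.
have a0 : (0 < a)%N by case: a h => [|//]; lia.
have [V hV] : exists V, (2 * a ^ 2 = V + 1)%N.
  by exists (2 * a ^ 2 - 1)%N; have : (0 < a ^ 2)%N; [rewrite expn_gt0 a0|lia].
have hVb : (V * (V + 2) = 3 * b ^ 4)%N.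
  by move: h; rewrite (expnM a 2 2); move: (a ^ 2)%N hV; clear; nia.
have [W hW] : exists W, (V + 2 = 3 * W)%N.
  have : (3 %| V * (V + 2))%N by rewrite hVb dvdn_mulr.
  rewrite Euclid_dvdM // => /orP[] /dvdnP[k kE]; last by exists k; lia.
  by have [l [] al] := square_mod3 a; lia.
have oV : odd V by have := f_equal odd hV; rewrite oddM oddD; case: (odd V).
have cop : coprime V W.
  apply: coprime_of_primes => p pp pV pW.
  have : (p %| V + 2)%N by rewrite hW dvdn_mull.
  rewrite dvdn_addr // dvdn_prime2 // => /eqP p2.
  by rewrite p2 dvdn2 oV in pV.
have [|v [w [Vv Ww bE]]] := @coprime_fourth _ _ b cop.
  by move: hVb; rewrite hW; clear; lia.
have v1 : (v ^ 2 = 1)%N.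
  apply: (@simultaneous_pell_neg _ a (w ^ 2)); rewrite -expnM;
    by move: hV hW Vv Ww; clear; lia.
have a1 : a = 1%N by move: hV; rewrite Vv (expnM v 2 2) v1; clear -a0; nia.
split=> //; move: h; rewrite a1 => hb.
have /eqP : (b ^ 4 = 1 ^ 4)%N by move: hb; move: (b ^ 4)%N; clear; lia.
by rewrite eqn_exp2r // => /eqP.
Qed.

(** The coprime [k] and [k + 1] each absorb the whole of 3 or of 4 or neither. Two distributions
    lead to the quartics above, the other two fail modulo 3. *)
Lemma pronic_eq_12fourth (k z : nat) :
  (k * (k + 1) = 12 * z ^ 4 -> z = 0 \/ z = 1 /\ k = 3)%N.
Proof.
move=> h.
have h3 : exists l, (k = 3 * l \/ k + 1 = 3 * l)%N.
  have : (3 %| k * (k + 1))%N by rewrite h (dvdn_mulr _ (isT : 3 %| 12))%N.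
  by rewrite Euclid_dvdM // => /orP[] /dvdnP[l lE]; exists l; lia.
have h4 : exists l, (k = 4 * l \/ k + 1 = 4 * l)%N.
  have [ok|ek] := boolP (odd k).
    have : (4 %| k * (k + 1))%N by rewrite h (dvdn_mulr _ (isT : 4 %| 12))%N.
    rewrite Gauss_dvdr; last by rewrite (coprimeXl 2 (_ : coprime 2 k)) // coprime2n.
    by move=> /dvdnP[l lE]; exists l; lia.
  have : (4 %| k * (k + 1))%N by rewrite h (dvdn_mulr _ (isT : 4 %| 12))%N.
  rewrite Gauss_dvdl; last first.
    by rewrite (coprimeXl 2 (_ : coprime 2 (k + 1))) // coprime2n addn1.
  by move=> /dvdnP[l lE]; exists l; lia.
have [l3 [k3|k3]] := h3; have [l4 [k4|k4]] := h4.
- have [l kl] : exists l, (k = 12 * l)%N by exists (k %/ 12); lia.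
  have cop : coprime l (k + 1) by apply: (@coprime_consec _ _ 12 1); lia.
  have [|g [f [hg hf zE]]] := @coprime_fourth _ _ z cop.
    by move: h; rewrite kl; clear; lia.
  left; rewrite zE (@fourth_eq_12fourth_add1 f g) //.
  by rewrite -hf -hg kl.
- have cop : coprime l3 l4 by apply: (@coprime_consec _ _ 3 4); lia.
  have [|b [a [hb ha zE]]] := @coprime_fourth _ _ z cop.
    by move: h; rewrite k4 k3; clear; lia.
  have [|a1 b1] := @mul4_fourth_eq_3fourth_add1 a b; first by rewrite -ha -hb -k4 k3.
  by right; rewrite zE a1 b1 k3 hb b1.
- have cop : coprime l4 l3 by apply: (@coprime_consec _ _ 4 3); lia.
  have [|a [b [ha hb zE]]] := @coprime_fourth _ _ z cop.
    by move: h; rewrite k3 k4; clear; lia.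
  have [l [] al] := fourth_mod3 a; lia.
- have [l kl] : exists l, (k + 1 = 12 * l)%N by exists ((k + 1) %/ 12); lia.
  have cop : coprime k l by apply: (@coprime_consec _ _ 1 12); lia.
  have [|f [g [hf hg zE]]] := @coprime_fourth _ _ z cop.
    by move: h; rewrite kl; clear; lia.
  have [m [] fm] := fourth_mod3 f; lia.
Qed.

(** * The system q^2 = 2 x^2 + 1, j^2 = 6 x^2 + 1 *)

Lemma symmetric_quartic (m n : nat) : ~~ odd m -> odd n ->
  (m ^ 4 + n ^ 4 = 4 * m ^ 2 * n ^ 2 + 1 -> m = 0 \/ m = 2 /\ n = 1)%N.
Proof.
move=> em on h.
have [z zE] : exists z, (m = 2 * z)%N by exists m./2; lia.
(* X = |n^2 - 2 m^2| *)
have [X [XE X2]] : exists X, (X ^ 2 = 3 * m ^ 4 + 1 /\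
    (2 * m ^ 2 + X = n ^ 2 \/ 2 * m ^ 2 = n ^ 2 + X))%N.
  move: h; rewrite (expnM m 2 2) (expnM n 2 2).
  move: (m ^ 2)%N (n ^ 2)%N => M N h.
  have [MN|MN] := leqP (2 * M) N.
    have [X NE] : exists X, N = (2 * M + X)%N by exists (N - 2 * M)%N; lia.
    by exists X; split; [move: h; rewrite NE; clear; lia|left].
  have [X NE] : exists X, (2 * M = N + X)%N by exists (2 * M - N)%N; lia.
  exists X; split; last by right.
  have : ((2 * M) ^ 2 = (N + X) ^ 2)%N by rewrite NE.
  have : (4 * M * N = 2 * N ^ 2 + 2 * N * X)%N by rewrite -mulnA [(_ * N)%N]mulnC; nia.
  by move: h; clear; lia.
have oX : odd X by have := f_equal odd XE; rewrite zE oddX oddD oddM oddX oddM.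
(* [X^2 = 48 z^4 + 1] turns into [k (k + 1) = 12 z^4]. *)
have [k kE] : exists k, (X = 2 * k + 1)%N by exists X./2; lia.
have hk : (k * (k + 1) = 12 * z ^ 4)%N by move: XE; rewrite kE zE; clear; lia.
have [z0|[z1 k3]] := pronic_eq_12fourth hk; first by left; rewrite zE z0.
right; have m2 : m = 2%N by rewrite zE z1.
(* Here [X = 7] and [2 m^2 = 8], so [n^2] is 15 or 1. *)
split=> //; move: X2; rewrite kE k3 m2; case; last by clear; nia.
by move=> n15; have : (n < 3 \/ 3 < n \/ n = 3)%N; [lia|nia].
Qed.

(** [P = (j - q)/2] and [P + q] are coprime with product [x^2], hence squares [m^2] and [n^2];
    substituting [q = n^2 - m^2] and [x = m n] in the first equation gives the symmetric quartic. *)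
Lemma simultaneous_pell_pos (q x j : nat) :
  (q ^ 2 = 2 * x ^ 2 + 1 -> j ^ 2 = 6 * x ^ 2 + 1 -> x = 0 \/ q = 3)%N.
Proof.
move=> hq hj.
have oq : odd q by have := f_equal odd hq; rewrite oddD oddX oddM.
have oj : odd j by have := f_equal odd hj; rewrite oddD oddX oddM.
have qj : (q <= j)%N by rewrite -(leq_exp2r _ _ (isT : 0 < 2)%N) hq hj; lia.
have [P jE] : exists P, (j = q + 2 * P)%N by exists ((j - q)./2); lia.
have hP : (P * (P + q) = x ^ 2)%N.
  by move: hj; rewrite jE; move: hq; clear; lia.
have cop : coprime P (P + q).
  apply: coprime_of_primes => p pp pP; rewrite dvdn_addr // => pq.
  have px : (p %| x)%N.
    have : (p %| x ^ 2)%N by rewrite -hP dvdn_mulr.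
    by rewrite Euclid_dvdX // andbT.
  have : (p %| 2 * x ^ 2 + 1)%N by rewrite -hq dvdn_exp.
  by rewrite dvdn_addr ?dvdn_mull ?dvdn_exp // dvdn1 => /eqP p1; rewrite p1 in pp.
have [m mE] := coprime_square cop hP.
have [n nE] : exists n, (P + q = n ^ 2)%N.
  by apply: (@coprime_square (P + q) P x); rewrite 1?coprime_sym 1?mulnC.
have xE : (x = m * n)%N.
  by apply/eqP; rewrite -(eqn_exp2r _ _ (isT : 0 < 2)%N) expnMn -mE -nE hP.
have h : (m ^ 4 + n ^ 4 = 4 * m ^ 2 * n ^ 2 + 1)%N.
  rewrite (expnM m 2 2) (expnM n 2 2) -mE -nE.
  by move: hq; rewrite -hP; clear; lia.
have omn : odd n = ~~ odd m.
  by have := f_equal odd nE; rewrite mE oddD !oddX oq /= => <-; case: odd.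
have [om|em] := boolP (odd m).
- have [||||[n2 m1]] := @symmetric_quartic n m.
  + by rewrite omn om.
  + by [].
  + by rewrite addnC h; clear; lia.
  + by move=> n0; left; rewrite xE n0 muln0.
  + by right; move: nE; rewrite mE n2 m1; clear; lia.
- have [||||[m2 n1]] := @symmetric_quartic m n; rewrite ?omn //.
  + by move=> m0; left; rewrite xE m0.
  + by move: nE; rewrite mE n1 m2; clear; lia.
Qed.

(** * The sequence [u] and the solutions of q^2 - 2 x^2 = 1 and -1 *)

Lemma u_step (m : nat) : ~~ odd m -> (0 < m)%N ->
  u (m + 2) = (u (m + 1) + u m)%N /\ u (m + 3) = (u (m + 1) + 2 * u m)%N.
Proof.
move=> em m0; have [k mE] : exists k, m = (2 * k.+1)%N by exists (m./2.-1); lia.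
have [_ _ _ /(_ k.+2 isT)] := uE.
have -> : (2 * k.+2 + 1 = m + 3)%N by lia.
have -> : (2 * k.+2 - 2 = m)%N by lia.
have -> : (2 * k.+2 - 1 = m + 1)%N by lia.
have -> : (2 * k.+2 = m + 2)%N by lia.
by case=> -> ->; split=> //; lia.
Qed.

(** Each pair [(x, q)] of consecutive terms with [x] at an even index is followed by
    [(q + x, q + 2 x)], that is, [q + x sqrt 2] is multiplied by [1 + sqrt 2]; the norm changes sign
    each time. *)
Lemma u_mod4 (n : nat) :
  [/\ u (4 * n + 4) = u (4 * n + 3) + u (4 * n + 2),
      u (4 * n + 5) = u (4 * n + 3) + 2 * u (4 * n + 2),
      u (4 * n.+1 + 2) = u (4 * n + 5) + u (4 * n + 4)
    & u (4 * n.+1 + 3) = u (4 * n + 5) + 2 * u (4 * n + 4)]%N.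
Proof.
have -> : (4 * n.+1 + 2 = 4 * n + 4 + 2)%N by lia.
have -> : (4 * n.+1 + 3 = 4 * n + 4 + 3)%N by lia.
have [||-> ->] := @u_step (4 * n + 4); [lia|lia|].
have -> : (4 * n + 5 = 4 * n + 2 + 3)%N by lia.
have -> : (4 * n + 4 = 4 * n + 2 + 2)%N by lia.
have [||-> ->] := @u_step (4 * n + 2); [lia|lia|].
have -> : (4 * n + 2 + 2 + 1 = 4 * n + 2 + 3)%N by lia.
have [||_ ->] := @u_step (4 * n + 2); [lia|lia|].
by have -> : (4 * n + 3 = 4 * n + 2 + 1)%N by lia.
Qed.

Lemma pell_u (n : nat) :
  (u (4 * n + 3) ^ 2 = 2 * u (4 * n + 2) ^ 2 + 1)%N.
Proof.
elim: n => [//|n IH]; have [h4 h5 -> ->] := u_mod4 n.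
by move: IH; rewrite h4 h5; clear; lia.
Qed.

Lemma pell_u_neg (n : nat) :
  (u (4 * n + 5) ^ 2 + 1 = 2 * u (4 * n + 4) ^ 2)%N.
Proof.
by have [-> -> _ _] := u_mod4 n; have := pell_u n; clear; lia.
Qed.

(** Division by [1 + sqrt 2] sends [(x, q)] to the smaller [(y, r) = (q - x, 2 x - q)] and swaps the
    two equations, which are therefore treated in one induction. *)
Lemma pell_descent (x q : nat) : (0 < x)%N ->
  (q ^ 2 = 2 * x ^ 2 + 1 -> exists n, q = u (4 * n + 3) /\ x = u (4 * n + 2))%N
  /\ (1 < q -> q ^ 2 + 1 = 2 * x ^ 2 ->
      exists n, q = u (4 * n + 5) /\ x = u (4 * n + 4))%N.
Proof.
elim/ltn_ind: x q => x IH q x0.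
have lt2 := @ltn_exp2r _ _ 2 isT; have le2 := @leq_exp2r _ _ 2 isT.
split=> [h|q1 h].
  have xq : (x < q)%N by rewrite -lt2 h; lia.
  have [y qE] : exists y, (q = x + y)%N by exists (q - x)%N; lia.
  have yx : (y <= x)%N.
    by rewrite leqNgt; apply/negP => yx; move: h; rewrite qE; nia.
  have [r xE] : exists r, (x = y + r)%N by exists (x - y)%N; lia.
  have hr : (r ^ 2 + 1 = 2 * y ^ 2)%N by move: h; rewrite qE xE; clear; lia.
  have r0 : (0 < r)%N by case: (r) hr => //; lia.
  have y0 : (0 < y)%N by case: (y) hr => //; lia.
  (* The descent ends at [(y, r) = (1, 1)], which comes from [x = 2], [q = 3]. *)
  have [r1|r1] := ltnP 1 r.
    have [|_ /(_ r1 hr) [n [rE yE]]] := IH y _ r y0; first by lia.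
    have [_ _ x' q'] := u_mod4 n; exists n.+1.
    by rewrite x' q' -rE -yE qE xE; clear; lia.
  exists 0%N; have rE : r = 1%N by lia.
  have yE : y = 1%N by move: hr; rewrite rE; clear; nia.
  by rewrite qE xE yE rE.
have xq : (x < q)%N by rewrite -lt2; have : (2 ^ 2 <= q ^ 2)%N; [rewrite le2|lia].
have [y qE] : exists y, (q = x + y)%N by exists (q - x)%N; lia.
have yx : (y <= x)%N.
  by rewrite leqNgt; apply/negP => yx; move: h; rewrite qE; nia.
have [r xE] : exists r, (x = y + r)%N by exists (x - y)%N; lia.
have hr : (r ^ 2 = 2 * y ^ 2 + 1)%N by move: h; rewrite qE xE; clear; lia.
have r0 : (0 < r)%N by case: (r) hr => //; lia.
have y0 : (0 < y)%N by lia.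
have [|/(_ hr) [n [rE yE]] _] := IH y _ r y0; first by lia.
have [x' q' _ _] := u_mod4 n; exists n.
by rewrite x' q' -rE -yE qE xE; clear; lia.
Qed.

Local Open Scope ring_scope.

(** * Representability of the squares (a - j)^2 *)

Lemma int_half (j : int) : exists h, j = 2 * h \/ j = 2 * h + 1.
Proof. by exists (j %/ 2)%Z; lia. Qed.

Lemma int_sqr_parity (j : int) : exists m, j ^+ 2 = j + 2 * m.
Proof.
have [h [->|->]] := int_half j.
- by exists (2 * h ^+ 2 - h); ring.
- by exists (2 * h ^+ 2 + h); ring.
Qed.

Lemma representable_sqrP (a : nat) (j : int) : odd a ->
  representable a (a + 2) ((a%:Z - j) ^+ 2) <->
  exists c, [/\ exists e, c = j + 2 * e, a%:Z * c <= j ^+ 2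
    & (j + 2) ^+ 2 <= (a%:Z + 2) * (c + 2)].
Proof.
move=> oa; have [k ak] : exists k : nat, a = (2 * k + 1)%N by exists a./2; lia.
have {}ak : a%:Z = 2 * k%:Z + 1 by lia.
split=> [[x [y]]|[c [[e ce] h1 h2]]].
  rewrite PoszD !PoszM PoszD; move: (a%:Z) ak => A AE h.
  exists (x%:Z + y%:Z - A + 2 * j); split.
  - have [m pm] := int_sqr_parity (A - j).
    exists (m - k%:Z * (x%:Z + y%:Z) - y%:Z); move: h pm; rewrite AE; clear; nia.
  - by move: h; clear; nia.
  - by move: h; clear; nia.
have [m jm] := int_sqr_parity j.
(* [Y] and [X] are half the slacks of the two inequalities; the parity of [c] makes them
   integers. *)
pose Y := m - e - k%:Z * c; pose X := a%:Z - j + 2 * e - Y.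
have Y2 : 2 * Y = j ^+ 2 - a%:Z * c by rewrite /Y jm ak ce; ring.
have X2 : 2 * X = (a%:Z + 2) * (c + 2) - (j + 2) ^+ 2.
  by rewrite /X mulrBr Y2 ce; ring.
exists `|X|%N, `|Y|%N; rewrite PoszD !PoszM PoszD !gez0_abs; lia.
Qed.

Lemma representable_sqr (a : nat) (e j : int) (c := j + 2 * e) : odd a ->
  a%:Z * c <= j ^+ 2 -> (j + 2) ^+ 2 <= (a%:Z + 2) * (c + 2) ->
  representable a (a + 2) ((a%:Z - j) ^+ 2).
Proof.
move=> oa h1 h2; apply/(representable_sqrP _ oa).
by exists c; split=> //; exists e.
Qed.

(** Take the largest [c] of the parity of [j] with [a c <= j^2]. Then [j^2 < a (c + 2)], and for
    [j < 0] also [(j + 2)^2 <= j^2]. *)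
Lemma representable_sqr_large (a : nat) (j : int) : odd a -> j <= 0 ->
  representable a (a + 2) ((a%:Z - j) ^+ 2).
Proof.
move=> oa j0; have a0 : 0 < a%:Z by lia.
have [->|jn] : j = 0 \/ j < 0 by lia.
  by apply: (@representable_sqr a 0) => //; lia.
have [e [e1 e2]] : exists e,
    a%:Z * (j + 2 * e) <= j ^+ 2 /\ j ^+ 2 < a%:Z * (j + 2 * e + 2).
  exists ((j ^+ 2 - a%:Z * j) %/ (2 * a%:Z))%Z.
  have := divz_eq (j ^+ 2 - a%:Z * j) (2 * a%:Z).
  have := @modz_ge0 (j ^+ 2 - a%:Z * j) (2 * a%:Z).
  have := @ltz_pmod (j ^+ 2 - a%:Z * j) (2 * a%:Z).
  move: (_ %/ _)%Z (_ %% _)%Z => d r /(_ ltac:(lia)) r1 /(_ ltac:(lia)) r2 h.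
  by move: h r1 r2; clear; lia.
apply: (@representable_sqr a e) => //.
have c0 : 0 < j + 2 * e + 2.
  by rewrite -(pmulr_rgt0 _ a0) (le_lt_trans (sqr_ge0 j) e2).
move: e1 e2 c0; move: (j + 2 * e) => c e1 e2 c0.
have j2 : j ^+ 2 <= a%:Z * (c + 2) by exact: ltW.
by move: j2 c0 jn; clear; nia.
Qed.

Lemma is_r2_sqr (a : nat) (J : int) : odd a -> (0 < a)%N -> J <= a%:Z ->
  ~ representable a (a + 2) ((a%:Z - J) ^+ 2) ->
  (forall j : int, 0 < j -> j < J -> representable a (a + 2) ((a%:Z - j) ^+ 2)) ->
  is_r2 a (a + 2) ((a%:Z - J) ^+ 2).
Proof.
move=> oa a0 Ja nJ H; split; first split=> //; first by rewrite addn_gt0 a0.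
  by rewrite /coprime gcdnDl -/(coprime a 2) coprimen2.
split=> //; first by exists (a%:Z - J).
move=> i; rewrite -(real_normK (num_real i)); move: (`|i|) (normr_ge0 i) => {}i i0 ni.
have [j iE] : exists j, i = a%:Z - j by exists (a%:Z - i); lia.
have Jj : J <= j.
  rewrite leNgt; apply/negP => jJ; apply: ni; rewrite iE.
  by have [j0|j0] := leP j 0; [apply: representable_sqr_large|apply: H].
by apply: lerXn2r; rewrite ?nnegrE; lia.
Qed.

(** * The first even gap and the odd gap *)

Lemma is_r2_even (a q l : nat) : odd a -> odd q ->
  a = (q ^ 2)%N \/ (a + 2)%N = (q ^ 2)%N ->
  (2 * l ^ 2 < a)%N -> (a + 2 < 2 * (l + 1) ^ 2)%N ->
  is_r2 a (a + 2) ((a%:Z - 2 * l%:Z) ^+ 2).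
Proof.
move=> oa oq aq la al.
have {}la : 2 * l%:Z ^+ 2 < a%:Z by lia.
have {}al : a%:Z + 2 < 2 * (l%:Z + 1) ^+ 2 by lia.
have {}aq : a%:Z <= q%:Z ^+ 2 <= a%:Z + 2 by lia.
have a0 : (0 < a)%N by lia.
move/andP: aq => [aq qa].
apply: is_r2_sqr => //.
- by case: (l) la => [|k]; nia.
- case/(representable_sqrP _ oa) => c [[e cE] h1 h2].
  (* The first inequality excludes even [c >= 2], the second excludes [c <= 0]. *)
  have {}h1 : a%:Z * c <= 4 * l%:Z ^+ 2 by lia.
  have c1 : c < 2 by rewrite -(ltr_pM2l (_ : 0 < a%:Z)); lia.
  have c0 : c + 2 <= 2 by lia.
  have : (a%:Z + 2) * (c + 2) <= (a%:Z + 2) * 2 by rewrite ler_wpM2l.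
  by move: h2 al; clear; lia.
(* Even [j] use [c = 0]. Odd [j] use [c = -1] up to [q - 2] and [c = 1] from [q] on:
   [a <= q^2 <= a + 2] leaves no gap between. *)
move=> j j0 jl; have [i [iE|iE]] := int_half j.
  apply: (@representable_sqr a (- i)) => //; rewrite iE ?mulNr ?mulrN subrr.
    by rewrite mulr0 sqr_ge0.
  have : (i + 1) ^+ 2 <= l%:Z ^+ 2 by apply: lerXn2r; rewrite ?nnegrE; lia.
  by move: la; clear; lia.
have [jq|jq] := ltP j (q%:Z - 1).
  apply: (@representable_sqr a (- i - 1)) => //.
    have -> : j + 2 * (- i - 1) = -1 by rewrite iE; ring.
    by have := sqr_ge0 j; lia.
  have -> : j + 2 * (- i - 1) = -1 by rewrite iE; ring.
  have : (j + 2) ^+ 2 <= q%:Z ^+ 2 by apply: lerXn2r; rewrite ?nnegrE; lia.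
  by move: qa; clear; lia.
have je : j + 2 * - i = 1 by rewrite iE; ring.
apply: (@representable_sqr a (- i)) => //; rewrite je.
  have : q%:Z ^+ 2 <= j ^+ 2 by apply: lerXn2r; rewrite ?nnegrE; lia.
  by move: aq; clear; lia.
have : (j + 2) ^+ 2 <= (2 * l%:Z + 1) ^+ 2 by apply: lerXn2r; rewrite ?nnegrE; lia.
(* [4 l <= 2 l^2 + 2] bounds [(2 l + 1)^2] by [6 l^2 + 3]. *)
have := sqr_ge0 (l%:Z - 1).
by move: la; clear; lia.
Qed.

(* The second alternative (the gap between c = 3 and c = 5) occurs for a = 7. *)
Lemma is_r2_odd (a q x : nat) (f : int) (J := 2 * f + 1) : odd a -> odd q ->
  (3 <= q)%N -> a = (q ^ 2)%N \/ (a + 2)%N = (q ^ 2)%N -> (a + 1 = 2 * x ^ 2)%N ->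
  0 <= f -> J ^+ 2 < 3 * q%:Z ^+ 2 -> 
  [\/ J ^+ 2 < 3 * a%:Z /\ 3 * (a%:Z + 2) < (J + 2) ^+ 2
    | J ^+ 2 < 5 * a%:Z /\ 5 * (a%:Z + 2) < (J + 2) ^+ 2] ->
  is_r2 a (a + 2) ((a%:Z - J) ^+ 2).
Proof.
move=> oa oq q3 aq ax f0 Jq aJ.
have {}ax : a%:Z + 1 = 2 * x%:Z ^+ 2 by lia.
have {}aq : a%:Z <= q%:Z ^+ 2 <= a%:Z + 2 by lia.
move/andP: aq => [aq qa].
have a0 : (0 < a)%N by lia.
have J0 : 0 < J by rewrite /J; lia.
have JE : J = 2 * f + 1 by [].
move: (J) JE J0 Jq aJ => {}J JE J0 Jq aJ.
have J2q : J + 1 <= 2 * q%:Z.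
  have [//|qJ] := leP (J + 1) (2 * q%:Z).
  have : (2 * q%:Z) ^+ 2 <= J ^+ 2 by apply: lerXn2r; rewrite ?nnegrE; lia.
  by move: Jq (sqr_ge0 q%:Z); clear; lia.
have qsq : 2 * q%:Z + 1 <= q%:Z ^+ 2 + 2 by have := sqr_ge0 (q%:Z - 1); clear; lia.
apply: is_r2_sqr => //.
- have : 3 * q%:Z <= q%:Z ^+ 2 by rewrite expr2 ler_wpM2r; lia.
  by move: J2q qa q3; clear; lia.
- case/(representable_sqrP _ oa) => c [[e cE] h1 h2].
  (* A gap at odd [k] leaves only [c = k - 1], which has the wrong parity. *)
  have step (k : int) : J ^+ 2 < k * a%:Z -> k * (a%:Z + 2) < (J + 2) ^+ 2 ->
      k < c + 2 /\ c < k.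
    move=> Jk kJ; have A2 : 0 < a%:Z + 2 by lia.
    rewrite -(ltr_pM2l A2) mulrC (lt_le_trans kJ h2); split=> //.
    by rewrite -(@ltr_pM2l _ a%:Z) // [_ * k]mulrC (le_lt_trans h1 Jk).
  by case: aJ => -[/step H {}/H]; lia.
move=> j j0 jJ; have [i [iE|iE]] := int_half j.
  (* [a + 1 = 2 x^2] closes the even gap: [c = 0] serves for [i < x] and [c = 2] from [i = x] on. *)
  have [ix|ix] := ltP i x%:Z.
    apply: (@representable_sqr a (- i)) => //; rewrite iE mulrN subrr.
      by rewrite mulr0 sqr_ge0.
    have : (i + 1) ^+ 2 <= x%:Z ^+ 2 by apply: lerXn2r; rewrite ?nnegrE; lia.
    by move: ax; clear; lia.
  have je : j + 2 * (1 - i) = 2 by rewrite iE; ring.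
  apply: (@representable_sqr a (1 - i)) => //; rewrite je.
    have : x%:Z ^+ 2 <= i ^+ 2 by apply: lerXn2r; rewrite ?nnegrE; lia.
    by move: ax; rewrite iE; clear; lia.
  have : (j + 2) ^+ 2 <= (2 * q%:Z) ^+ 2 by apply: lerXn2r; rewrite ?nnegrE; lia.
  by move: qa; clear; lia.
have [jq|jq] := ltP j (q%:Z - 1).
  have je : j + 2 * (- i - 1) = -1 by rewrite iE; ring.
  apply: (@representable_sqr a (- i - 1)) => //; rewrite je.
    by have := sqr_ge0 j; lia.
  have : (j + 2) ^+ 2 <= q%:Z ^+ 2 by apply: lerXn2r; rewrite ?nnegrE; lia.
  by move: qa; clear; lia.
have je : j + 2 * - i = 1 by rewrite iE; ring.
apply: (@representable_sqr a (- i)) => //; rewrite je.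
  have : q%:Z ^+ 2 <= j ^+ 2 by apply: lerXn2r; rewrite ?nnegrE; lia.
  by move: aq; clear; lia.
have : (j + 2) ^+ 2 <= J ^+ 2 by apply: lerXn2r; rewrite ?nnegrE; lia.
by move: Jq qa; clear; lia.
Qed.

(** * The two floors as inequalities between integers *)

Lemma int_le_mul_sqrt (R : realType) (q c : nat) (k : int) : 0 <= k ->
  (k%:~R <= q%:R * Num.sqrt c%:R :> R) = (k ^+ 2 <= (c * q ^ 2)%N%:Z).
Proof.
move=> k0.
rewrite -(ler_pXn2r (_ : 0 < 2)%N) ?nnegrE ?ler0z ?mulr_ge0 ?sqrtr_ge0 //.
rewrite exprMn sqr_sqrtr // -natrX -natrM mulnC -rmorphXn /=.
by rewrite [X in _ <= X]pmulrn ler_int.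
Qed.

Lemma floor_half_sqrt2 (R : realType) (q : nat) : exists l : nat,
  [/\ Num.floor (q%:R * Num.sqrt 2 / 2 : R) = l%:Z,
      2 * l ^ 2 <= q ^ 2 & q ^ 2 < 2 * (l + 1) ^ 2]%N.
Proof.
set s := q%:R * Num.sqrt 2.
have s0 : 0 <= s by rewrite mulr_ge0 ?sqrtr_ge0.
have /andP[] := floor_itv (s / 2); have : 0 <= Num.floor (s / 2).
  by rewrite floor_ge0 divr_ge0.
case: (Num.floor _) => // l _ h1 h2; exists l; split=> //.
  suff : (2 * l%:Z) ^+ 2 <= (2 * q ^ 2)%N%:Z by lia.
  by rewrite -(@int_le_mul_sqrt R) // intrM -/s; lra.
suff : ~~ ((2 * (l%:Z + 1)) ^+ 2 <= (2 * q ^ 2)%N%:Z) by lia.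
by rewrite -(@int_le_mul_sqrt R) // intrM -/s -ltNge; lra.
Qed.

(** [2 f + 1] is the largest odd integer not exceeding [q sqrt 3]. *)
Lemma floor_half_sqrt3 (R : realType) (q : nat) : (0 < q)%N -> exists f : nat,
  [/\ Num.floor ((q%:R * Num.sqrt 3 - 1) / 2 : R) = f%:Z,
      (2 * f + 1) ^ 2 <= 3 * q ^ 2 & 3 * q ^ 2 < (2 * f + 3) ^ 2]%N.
Proof.
move=> q0; set s := q%:R * Num.sqrt 3.
have s1 : 1 <= s by rewrite -[1]/(1%:~R) int_le_mul_sqrt //; lia.
have /andP[] := floor_itv ((s - 1) / 2); have : 0 <= Num.floor ((s - 1) / 2).
  by rewrite floor_ge0 divr_ge0 // subr_ge0.
case: (Num.floor _) => // f _ h1 h2; exists f; split=> //.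
  suff : (2 * f%:Z + 1) ^+ 2 <= (3 * q ^ 2)%N%:Z by lia.
  by rewrite -(@int_le_mul_sqrt R) // intrD intrM -/s; lra.
suff : ~~ ((2 * (f%:Z + 1) + 1) ^+ 2 <= (3 * q ^ 2)%N%:Z) by lia.
by rewrite -(@int_le_mul_sqrt R) // intrD intrM -/s -ltNge; lra.
Qed.

(** Odd squares are 1 modulo 8, so the differences to [3 q^2] are 2 and 6 modulo 8. Only the values
    2 and 6 themselves can spoil the bounds [3 a] and [3 (a + 2)]. *)
Lemma three_sqr_gap (q J : nat) : odd q -> odd J ->
  (J ^ 2 <= 3 * q ^ 2 < (J + 2) ^ 2)%N ->
  [/\ J ^ 2 + 2 = 3 * q ^ 2 \/ J ^ 2 + 10 <= 3 * q ^ 2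
    & (J + 2) ^ 2 = 3 * q ^ 2 + 6 \/ 3 * q ^ 2 + 14 <= (J + 2) ^ 2]%N.
Proof.
move=> oq oJ; have [s ->] := odd_square oq; have [t ->] := odd_square oJ.
have oJ2 : odd (J + 2) by rewrite oddD oJ.
have [r ->] := odd_square oJ2.
by lia.
Qed.

(** * The four cases of the formula *)

Theorem theorem5 (R : realType) :
  (forall a b : nat, (1 <= b)%N -> a = ((2 * b + 1) ^ 2)%N ->
     (~ (exists n : nat, (1 <= n)%N /\ (2 * b + 1)%N = u (4 * n + 1)) ->
        is_r2 a (a + 2)
          ((a%:Z - 2 * Num.floor ((2 * b + 1)%:R * Num.sqrt 2 / 2 : R)) ^+ 2))
     /\
     ((exists n : nat, (1 <= n)%N /\ (2 * b + 1)%N = u (4 * n + 1)) ->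
        is_r2 a (a + 2)
          ((a%:Z - 2 * Num.floor (((2 * b + 1)%:R * Num.sqrt 3 - 1) / 2 : R)
            - 1) ^+ 2)))
  /\
  (forall a b : nat, (1 <= b)%N -> (a + 2)%N = ((2 * b + 1) ^ 2)%N ->
     (~ (exists n : nat, (2 * b + 1)%N = u (4 * n + 3)) ->
        is_r2 a (a + 2)
          ((a%:Z - 2 * Num.floor ((2 * b + 1)%:R * Num.sqrt 2 / 2 : R)) ^+ 2))
     /\
     ((exists n : nat, (2 * b + 1)%N = u (4 * n + 3)) ->
        is_r2 a (a + 2)
          ((a%:Z - 2 * Num.floor (((2 * b + 1)%:R * Num.sqrt 3 - 1) / 2 : R)
            - 1) ^+ 2))).
Proof.
have oddq b : odd (2 * b + 1) by rewrite oddD oddM.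
split=> a b b1 aq; have q3 : (3 <= 2 * b + 1)%N by lia.
all: move: (2 * b + 1)%N (oddq b) q3 aq => q oq q3 aq.
all: have oq2 : odd (q ^ 2) by rewrite oddX oq.
all: have oa : odd a by lia.
all: have [l [-> l1 l2]] := floor_half_sqrt2 R q.
all: have [|f [-> f1 f2]] := @floor_half_sqrt3 R q; first by lia.
all: have [||E1 E2] := @three_sqr_gap q (2 * f + 1) oq; [lia|lia|].
- split=> [nE|[n [n1 qn]]].
    apply: (@is_r2_even a q l) => //; [by left|lia|].
    (* By parity, [q^2 + 2 < 2 (l + 1)^2] fails only if [2 (l + 1)^2 = q^2 + 1]. *)
    have [h|] := eqVneq (2 * (l + 1) ^ 2)%N (q ^ 2 + 1)%N; last by lia.
    have l0 : (0 < l + 1)%N by rewrite addn1.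
    case: nE; have [_ D] := @pell_descent (l + 1) q l0.
    have [||n [qn _]] := D; [lia|lia|].
    by exists n.+1; split=> //; rewrite qn; congr u; lia.
  have := pell_u_neg n.-1.
  have -> : (4 * n.-1 + 5 = 4 * n + 1)%N by lia.
  rewrite -qn => x2; rewrite -addrA -opprD.
  apply: (@is_r2_odd a q (u (4 * n.-1 + 4))) => //; [by left|by lia|by lia|].
  (* The bound fails only if [(2 f + 3)^2 = 3 q^2 + 6]; then [2 f + 3 = 3 w] and
     [q^2 + 2 = 3 w^2]. *)
  left; case: E2 => [E2|E2]; last by move: aq E1 E2; clear; lia.
  have [w hw] : exists w, (2 * f + 1 + 2 = 3 * w)%N.
    have : (3 %| (2 * f + 1 + 2) ^ 2)%N by rewrite E2 dvdn_add // dvdn_mulr.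
    by rewrite Euclid_dvdX // andbT => /dvdnP[w ->]; exists w; lia.
  suff : q = 1%N by lia.
  by apply: (simultaneous_pell_neg x2 (w := w)); move: E2; rewrite hw; clear; lia.
- split=> [nE|[n qn]].
    apply: (@is_r2_even a q l) => //; [by right| |lia].
    (* By parity, [2 l^2 < q^2 - 2] fails only if [2 l^2 + 1 = q^2]. *)
    have [h|] := eqVneq (2 * l ^ 2 + 1)%N (q ^ 2)%N; last by lia.
    have l0 : (0 < l)%N by case: (l) h => //; nia.
    case: nE; have [D _] := @pell_descent l q l0.
    have [|n [qn _]] := D; first by lia.
    by exists n.
  have := pell_u n; rewrite -qn; move: (u _) => x x2; rewrite -addrA -opprD.
  apply: (@is_r2_odd a q x) => //; [by right|by lia|by lia|].
  (* If [J = 2 f + 1] has [J^2 + 2 = 3 q^2], then [J^2 = 6 x^2 + 1], the second system. *)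
  case: E1 => [E1|E1]; last by left; move: aq E1 f2; clear; lia.
  have [|x0|q3'] := simultaneous_pell_pos x2 (j := 2 * f + 1); first by lia.
    by move: x2 q3; rewrite x0; clear; nia.
  (* [q = 3], [J = 5], [a = 7]: here [25 < 5 * 7] and [5 * 9 < 49]. *)
  by right; move: E1 E2 aq; rewrite q3'; clear; nia.
Qed.
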